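(* Let $G$ be an out-tree. Then for every derivation $\delta$ on $\mathcal{A}_G$, there exists $T\in\mathcal{A}_G$ such that $\delta=\delta_T$ and $\|T\|\leq\|\delta\|$.
   Context: A directed graph $G=(\mathcal{V},\mathcal{E},s,r)$ has a vertex set $\mathcal{V}$, an edge set $\mathcal{E}$, and source and range maps $s,r\colon\mathcal{E}\to\mathcal{V}$; an edge $e$ is an arrow from $s(e)$ to $r(e)$. $\mathbb{F}_G^+$ is the set of all directed paths of finite length: vertices $v$ are paths of length $0$ with $r(v)=s(v)=v$, and a path of length $n\geq1$ is $p=e_1e_2\cdots e_n$ with $s(e_j)=r(e_{j+1})$, $r(p)=r(e_1)$, $s(p)=s(e_n)$; if $s(p_1)=r(p_2)$, the product $p_1p_2$ is the concatenation. Let $\mathcal{H}_G=\ell^2(\mathbb{F}_G^+)$ with orthonormal basis $\{\xi_w\}$. For $e\in\mathcal{E}$, $L_e\xi_w=\xi_{ew}$ if $r(w)=s(e)$ and $0$ otherwise; for $x\in\mathcal{V}$, $L_x\xi_w=\xi_w$ if $r(w)=x$ and $0$ otherwise. $\mathcal{A}_G$ is the norm-closed algebra generated by $\{L_e,L_x\colon e\in\mathcal{E},x\in\mathcal{V}\}$ in $B(\mathcal{H}_G)$, with the operator norm. A derivation on $\mathcal{A}_G$ is a linear map $\delta\colon\mathcal{A}_G\to\mathcal{A}_G$ with $\delta(AB)=\delta(A)B+A\delta(B)$; $\delta_T(A)=AT-TA$. A polygon of length $n\geq1$ is a set of distinct vertices $v_1,\dots,v_n$ and distinct edges $e_1,\dots,e_n$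 with $\{r(e_j),s(e_j)\}=\{v_j,v_{j+1\,(\mathrm{mod}\,n)}\}$. A tree is a connected (as an undirected graph) directed graph with finitely many, and at least two, vertices containing no polygon. An out-tree is a tree having a vertex $v_s$ such that for each vertex $v$ there is a directed path from $v_s$ to $v$. *)

(* Defs.v *)
From HB Require Import structures.
From Stdlib Require Import Relation_Operators.
From mathcomp Require Import all_boot all_order all_algebra.
From mathcomp Require Import complex.
From mathcomp Require Import all_classical all_reals all_analysis.
From mathcomp Require Import ring lra.
Set Implicit Arguments.
Unset Strict Implicit.
Unset Printing Implicit Defensive.
Import Order.TTheory GRing.Theory Num.Theory.
Local Open Scope classical_set_scope.
Local Open Scope ring_scope.

(* Vertex and edge sets are arbitrary, possibly infinite; choiceType only
   makes the sums over paths (esum) available. *)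
Record digraph := Digraph {
  vertex : choiceType;
  edge : choiceType;
  src : edge -> vertex;
  rng : edge -> vertex
}.

Section Paths.
Variable G : digraph.

(* The path e_1 ... e_n with source x is encoded by (x, [:: e_1; ...; e_n]);
   the vertex x, as a path of length 0, by (x, [::]). *)
Definition walk_rng (x : vertex G) (es : seq (edge G)) : vertex G :=
  if es is e :: _ then rng e else x.

Fixpoint is_walk (x : vertex G) (es : seq (edge G)) : bool :=
  if es is e :: es' then (src e == walk_rng x es') && is_walk x es' else true.

Definition dpath : choiceType :=
  {w : vertex G * seq (edge G) | is_walk w.1 w.2}.

Definition psrc (w : dpath) : vertex G := (val w).1.
Definition prng (w : dpath) : vertex G := walk_rng (val w).1 (val w).2.

(* The product e w, which is None unless r(w) = s(e). *)
Definition pcons (e : edge G) (w : dpath) : option dpath :=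
  insub ((val w).1, e :: (val w).2).

(* The w such that p = e w, if there is one. *)
Definition puncons (e : edge G) (p : dpath) : option dpath :=
  if (val p).2 is e' :: es then
    if e' == e then insub ((val p).1, es) else None
  else None.

Lemma pcons_defined e w : isSome (pcons e w) = (src e == prng w).
Proof.
rewrite /pcons; case: insubP => /= [u + _|]; rewrite (valP w) andbT.
  by move=> ->.
by move/negbTE=> ->.
Qed.

Lemma punconsP e p w : puncons e p = Some w <-> pcons e w = Some p.
Proof.
have insubE z (u : dpath) : insub z = Some u <-> val u = z.
  by split=> [|<-]; [case: insubP => // v _ <- [->]|exact: valK].
rewrite /pcons insubE /puncons; case: (val p) => x [|e' es] //=.
case: eqP => [->|ne]; last by split=> // -[_ /ne].
by rewrite insubE; case: w => -[y fs] hw /=; split=> [[-> ->]|[-> ->]].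
Qed.

End Paths.

Section Ell2.
Variables (R : realType) (I : choiceType).
Local Notation C := R[i].

Definition sqnorm (f : I -> C) : \bar R :=
  \esum_(i in [set: I]) ((Normc.normc (f i)) ^+ 2)%:E.

Definition ell2_pred : {pred (I -> C)} := [pred f | `[< (sqnorm f < +oo)%E >]].

Lemma normc2 (z : C) : Normc.normc z ^+ 2 = complex.Re z ^+ 2 + complex.Im z ^+ 2.
Proof. by case: z => a b /=; rewrite sqr_sqrtr// addr_ge0 ?sqr_ge0. Qed.

Lemma sqnorm_ge0 f : (0 <= sqnorm f)%E.
Proof. by apply: esum_ge0 => i _; rewrite lee_fin sqr_ge0. Qed.

Lemma sqnorm0 : sqnorm 0 = 0%E.
Proof. by rewrite /sqnorm esum1// => i _; rewrite Normc.normc0 expr0n. Qed.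

Lemma esumZ (c : R) (a : I -> R) : 0 <= c -> (forall i, 0 <= a i) ->
  (\esum_(i in [set: I]) (c * a i)%:E = c%:E * \esum_(i in [set: I]) (a i)%:E)%E.
Proof.
move=> c0 a0.
suff le (d : R) (b : I -> R) : 0 <= d -> (forall i, 0 <= b i) ->
  (\esum_(i in [set: I]) (d * b i)%:E <= d%:E * \esum_(i in [set: I]) (b i)%:E)%E.
  apply/eqP; rewrite eq_le le//=.
  have [->|cN0] := eqVneq c 0.
    by rewrite mul0e; apply: esum_ge0 => i _; rewrite mul0r.
  have {cN0}c0 : 0 < c by rewrite lt0r cN0.
  rewrite -lee_pdivlMl//.
  apply: le_trans (le _ (fun i => c * a i) _ _); last 2 first.
  - by rewrite invr_ge0 ltW.
  - by move=> i; rewrite mulr_ge0// ltW.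
  by apply: le_esum => i _; rewrite mulKf// gt_eqF.
move=> d0 b0; apply: ge_ereal_sup => _ [X [finX _] <-].
have -> : (\sum_(x \in X) (d * b x)%:E = d%:E * \sum_(x \in X) (b x)%:E)%E.
  rewrite !fsbig_finite//= ge0_sume_distrr//.
  by move=> i _; rewrite lee_fin.
by rewrite lee_wpmul2l ?lee_fin//; apply: ereal_sup_ubound; exists X.
Qed.

Lemma sqnormZ a f : sqnorm (a *: f) = ((Normc.normc a ^+ 2)%:E * sqnorm f)%E.
Proof.
rewrite /sqnorm -esumZ ?sqr_ge0//; last by move=> i; rewrite sqr_ge0.
by apply: eq_esum => i _; rewrite -exprMn -Normc.normcM.
Qed.

Lemma sqnormD f g : (sqnorm (f + g)%R <= 2%:E * (sqnorm f + sqnorm g))%E.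
Proof.
rewrite /sqnorm -esumD; try by move=> i _; rewrite lee_fin sqr_ge0.
under [X in (_ <= _ * X)%E]eq_esum => i _ do rewrite -EFinD.
rewrite -esumZ//; last by move=> i; rewrite addr_ge0 ?sqr_ge0.
apply: le_esum => i _; rewrite lee_fin !normc2.
rewrite [(f + g) i]/(f i + g i); case: (f i) => a b; case: (g i) => c d /=.
have := sqr_ge0 (a - c); have := sqr_ge0 (b - d); nra.
Qed.

Lemma ell2P f : reflect (sqnorm f < +oo)%E (f \in ell2_pred).
Proof. exact: asboolP. Qed.

Lemma ell2_submod : GRing.submod_closed ell2_pred.
Proof.
split=> [|a f g]; first by apply/ell2P; rewrite sqnorm0 ltry.
move=> /ell2P hf /ell2P hg; apply/ell2P.
apply: le_lt_trans (sqnormD _ _) _; rewrite sqnormZ.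
apply: lte_mul_pinfty => //; apply: lte_add_pinfty => //.
by apply: lte_mul_pinfty => //; rewrite lee_fin sqr_ge0.
Qed.

HB.instance Definition _ :=
  GRing.isSubmodClosed.Build C (I -> C) ell2_pred ell2_submod.

(* The Hilbert space l^2(I). *)
Record ell2 := Ell2 { ell2_fun :> I -> C; _ : ell2_fun \in ell2_pred }.

HB.instance Definition _ := [isSub for ell2_fun].
HB.instance Definition _ := [Choice of ell2 by <:].
HB.instance Definition _ := [SubChoice_isSubLmodule of ell2 by <:].

Definition ell2_norm (f : ell2) : R := Num.sqrt (fine (sqnorm f)).

Lemma basis_subproof (w : I) :
  (fun i => if i == w then 1 else 0 : C) \in ell2_pred.
Proof.
apply/ell2P; rewrite /sqnorm.
rewrite (esumID [set w])//; last by move=> i _; rewrite lee_fin sqr_ge0.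
rewrite setTI esum_set1 ?lee_fin ?sqr_ge0//.
rewrite esum1 ?adde0 ?ltry// => i /= [_ iw].
by case: eqP iw => // _ _; rewrite Normc.normc0 expr0n.
Qed.

Definition basis (w : I) : ell2 := Ell2 (basis_subproof w).

End Ell2.

Section Operators.
Variables (R : realType) (I : choiceType).
Local Notation C := R[i].

(* Sums and scalar multiples of operators are the pointwise ones of the
   function space; their product is composition. *)
Definition operator := ell2 R I -> ell2 R I.

Implicit Types (S T : operator) (X : set operator).

Definition opnorm T : \bar R :=
  ereal_sup [set (ell2_norm (T x))%:E | x in [set x | ell2_norm x <= 1]].

(* B(l^2(I)). *)
Definition bounded_op : set operator :=
  [set T | linear T /\ (opnorm T < +oo)%E].

Definition closed_subalgebra X : Prop :=
  [/\ X `<=` bounded_op,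
      X 0,
      forall (a : C) S T, X S -> X T -> X (a *: S + T),
      forall S T, X S -> X T -> X (S \o T) &
      forall T, bounded_op T ->
        (forall eps : R, 0 < eps -> exists2 S, X S & (opnorm (T - S)%R < eps%:E)%E) ->
        X T].

(* A derivation X -> X is the restriction to X of delta, whose values outside
   X are irrelevant. *)
Definition derivation_on X (delta : operator -> operator) : Prop :=
  [/\ set_fun X X delta,
      forall (a : C) A B, X A -> X B ->
        delta (a *: A + B) = a *: delta A + delta B &
      forall A B, X A -> X B ->
        delta (A \o B) = (delta A \o B) + (A \o delta B)].

Definition delta_ T (A : operator) : operator := (A \o T) - (T \o A).

Lemma sqnormE (f : ell2 R I) : sqnorm f = (ell2_norm f ^+ 2)%:E.
Proof.
have /ell2P hf := valP f.
rewrite /ell2_norm sqr_sqrtr ?fine_ge0 ?sqnorm_ge0// fineK//.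
by rewrite ge0_fin_numE ?sqnorm_ge0.
Qed.

Lemma ell2_norm_le (f : ell2 R I) (M : R) :
  0 <= M -> (ell2_norm f <= M) = (sqnorm f <= (M ^+ 2)%:E)%E.
Proof.
by move=> M0; rewrite sqnormE lee_fin ler_pXn2r ?nnegrE// sqrtr_ge0.
Qed.

Lemma bounded_opP T : bounded_op T <->
  linear T /\ exists2 M : R, 0 <= M &
    forall x, ell2_norm x <= 1 -> ell2_norm (T x) <= M.
Proof.
split=> -[linT]; last first.
  move=> [M _ TM]; split=> //; apply: le_lt_trans (ltry M).
  by apply: ge_ereal_sup => _ [x /= x1 <-]; rewrite lee_fin TM.
move=> Toop; split=> //.
have le x : ell2_norm x <= 1 -> ((ell2_norm (T x))%:E <= opnorm T)%E.
  by move=> x1; apply: ereal_sup_ubound; exists x.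
have T0 : (0 <= opnorm T)%E.
  apply: le_trans (le 0 _); first by rewrite lee_fin sqrtr_ge0.
  by rewrite ell2_norm_le// [X in (X <= _)%E]sqnorm0 lee_fin.
exists (fine (opnorm T)); first exact: fine_ge0.
by move=> x /le; rewrite -lee_fin fineK// ge0_fin_numE.
Qed.

Lemma bounded_op_closed : closed_subalgebra bounded_op.
Proof.
split=> //.
- apply/bounded_opP; split=> [a x y|]; first by rewrite /= scaler0 addr0.
  by exists 0 => // x _; rewrite ell2_norm_le// [X in (X <= _)%E]sqnorm0 expr0n.
- move=> a S T /bounded_opP[linS [M M0 SM]] /bounded_opP[linT [N N0 TN]].
  apply/bounded_opP; split=> [b x y|].
    rewrite -[LHS]/(a *: S (b *: x + y) + T (b *: x + y)).
    rewrite -[(a *: S + T) x]/(a *: S x + T x) -[(a *: S + T) y]/(a *: S y + T y).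
    by rewrite linS linT !scalerDr !scalerA (mulrC a) addrACA.
  pose K := 2 * (Normc.normc a ^+ 2 * M ^+ 2 + N ^+ 2).
  have K0 : 0 <= K by apply: mulr_ge0 => //; rewrite -exprMn addr_ge0 ?sqr_ge0.
  exists (Num.sqrt K) => [|x x1]; first exact: sqrtr_ge0.
  rewrite ell2_norm_le ?sqrtr_ge0// sqr_sqrtr//.
  have le : (sqnorm ((a *: S + T)%R x) <=
      2%:E * ((Normc.normc a ^+ 2)%:E * sqnorm (S x) + sqnorm (T x)))%E.
    by rewrite -sqnormZ; exact: sqnormD.
  apply: le_trans le _.
  rewrite !sqnormE -EFinM lee_fin ler_pM2l// lerD//.
    rewrite ler_wpM2l ?sqr_ge0// ler_pXn2r ?nnegrE// ?sqrtr_ge0//; exact: SM.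
  by rewrite ler_pXn2r ?nnegrE// ?sqrtr_ge0//; exact: TN.
- move=> S T /bounded_opP[linS [M M0 SM]] /bounded_opP[linT [N N0 TN]].
  apply/bounded_opP; split=> [b x y|]; first by rewrite /= linT linS.
  exists ((N + 1) * M) => [|x x1]; first by rewrite mulr_ge0// addr_ge0.
  have N1 : 0 < N + 1 by rewrite ltr_wpDl.
  have scaleS (c : C) y : S (c *: y) = c *: S y.
    have S0 : S 0 = 0.
      have := linS (-1) 0 0; rewrite scaler0 addr0 scaleN1r addNr; exact.
    by have := linS c y 0; rewrite S0 !addr0.
  have normc_re (c : R) : Normc.normc (c%:C)%C ^+ 2 = c ^+ 2.
    by rewrite normc2 /= expr0n addr0.
  pose y := ((N + 1)^-1)%:C%C *: T x.
  have Ty : T x = (N + 1)%:C%C *: y.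
    by rewrite /y scalerA -rmorphM /= divff ?gt_eqF// scale1r.
  have y1 : ell2_norm y <= 1.
    rewrite ell2_norm_le// [X in (X <= _)%E]sqnormZ normc_re sqnormE -EFinM lee_fin.
    rewrite -exprMn ler_pXn2r ?nnegrE// ?mulr_ge0 ?invr_ge0 ?sqrtr_ge0// 1?ltW//.
    by rewrite ltr_pdivrMl// mulr1 (le_lt_trans (TN _ x1))// ltrDl.
  rewrite ell2_norm_le ?mulr_ge0// ?(ltW N1)//= Ty scaleS.
  rewrite [X in (X <= _)%E]sqnormZ normc_re sqnormE -EFinM lee_fin.
  rewrite exprMn ler_wpM2l ?sqr_ge0// ler_pXn2r ?nnegrE// ?sqrtr_ge0//; exact: SM.
Qed.

(* The operator norm of a linear map on the normed space X. *)
Definition norm_on X (delta : operator -> operator) : \bar R :=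
  ereal_sup [set opnorm (delta A) | A in [set A | X A /\ (opnorm A <= 1)%E]].

End Operators.

Section PathAlgebra.
Variables (R : realType) (G : digraph).
Local Notation C := R[i].
Local Notation H := (ell2 R (dpath G)).

Lemma pull_sqnorm (I : choiceType) (u : I -> option I) (f : I -> C) :
  (forall p q w, u p = Some w -> u q = Some w -> p = q) ->
  (sqnorm (fun p => if u p is Some w then f w else 0%R) <= sqnorm f)%E.
Proof.
move=> uinj; rewrite /sqnorm.
pose A := [set p | isSome (u p)].
rewrite (esumID A)//; last by move=> i _; rewrite lee_fin sqr_ge0.
rewrite !setTI [X in (_ + X)%E]esum1 ?adde0; last first.
  by move=> p /=; rewrite /A /=; case: (u p) => // _; rewrite Normc.normc0 expr0n.
pose e p := odflt p (u p).
rewrite [leLHS](_ : _ =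
    \esum_(p in A) ((Normc.normc (f (e p))) ^+ 2)%:E); last first.
  by apply: eq_esum => p; rewrite /A /e /=; case: (u p).
rewrite -(esum_image A e (fun q => ((Normc.normc (f q)) ^+ 2)%:E)); last first.
  move=> p q; rewrite !inE /A /e /=.
  case up: (u p) => [w|]//; case uq: (u q) => [w'|]// _ _ /= ww'.
  by apply: uinj up _; rewrite ww'.
rewrite [leLHS]esum_mkcond; apply: le_esum => q _.
by case: ifP => // _; rewrite lee_fin sqr_ge0.
Qed.

Lemma puncons_inj e (p q w : dpath G) :
  puncons e p = Some w -> puncons e q = Some w -> p = q.
Proof. by move=> /punconsP + /punconsP => -> [->]. Qed.

Lemma L_edge_subproof e (f : H) :
  (fun p => if puncons e p is Some w then f w else 0) \in @ell2_pred R (dpath G).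
Proof.
apply/ell2P; apply: le_lt_trans (pull_sqnorm _ _) _.
  exact: puncons_inj.
by apply/ell2P; have := valP f.
Qed.

(* L_e, by its action on coordinates; see L_edge_basis. *)
Definition L_edge (e : edge G) : operator R (dpath G) :=
  fun f => Ell2 (L_edge_subproof e f).

Lemma vproj_inj x (p q w : dpath G) :
  (if prng p == x then Some p else None) = Some w ->
  (if prng q == x then Some q else None) = Some w -> p = q.
Proof. by case: ifP => // _ [->]; case: ifP => // _ [->]. Qed.

Lemma L_vertex_subproof x (f : H) :
  (fun p => if prng p == x then f p else 0) \in @ell2_pred R (dpath G).
Proof.
apply/ell2P.
rewrite (_ : (fun p => _) = fun p =>
    if (if prng p == x then Some p else None) is Some w then f w else 0).
  apply: le_lt_trans (pull_sqnorm _ (@vproj_inj x)) _.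
  by apply/ell2P; have := valP f.
by apply/funext => p; case: ifP.
Qed.

Definition L_vertex (x : vertex G) : operator R (dpath G) :=
  fun f => Ell2 (L_vertex_subproof x f).

Lemma L_edge_basis e (w : dpath G) :
  L_edge e (basis R w) = if pcons e w is Some ew then basis R ew else 0.
Proof.
apply/val_inj/funext => p /=.
case ep: (puncons e p) => [w'|].
  have /punconsP wp := ep; case: eqP => [w'w|w'w].
    by rewrite -w'w wp /= eqxx.
  case wq: (pcons e w) => [q|//] /=; case: eqP => // pq; subst q.
  by case: w'w; move/punconsP: wq; rewrite ep => -[].
case wq: (pcons e w) => [q|//] /=; case: eqP => // pq; subst q.
by move/punconsP: wq; rewrite ep.
Qed.

Lemma L_vertex_basis x (w : dpath G) :
  L_vertex x (basis R w) = if prng w == x then basis R w else 0.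
Proof.
apply/val_inj/funext => p /=.
have [->|pw] := eqVneq p w; first by case: ifP => //=; rewrite eqxx.
by rewrite if_same; case: ifP => //= _; rewrite (negbTE pw).
Qed.

Definition generators : set (operator R (dpath G)) := range L_edge `|` range L_vertex.

(* The norm-closed algebra A_G generated by the L_e and the L_x. *)
Definition path_algebra : set (operator R (dpath G)) :=
  smallest (@closed_subalgebra R (dpath G)) generators.

Lemma generators_bounded : generators `<=` @bounded_op R (dpath G).
Proof.
move=> T [[e _ <-]|[x _ <-]]; apply/bounded_opP; split.
- move=> a f g; apply/val_inj/funext => p /=.
  rewrite -[RHS]/(a * (if puncons e p is Some w then f w else 0) +
                  (if puncons e p is Some w then g w else 0)).
  by case: (puncons e p) => //; rewrite mulr0 addr0.
- exists 1 => // f; rewrite !ell2_norm_le//; apply: le_trans.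
  by apply: pull_sqnorm; exact: puncons_inj.
- move=> a f g; apply/val_inj/funext => p /=.
  rewrite -[RHS]/(a * (if prng p == x then f p else 0) +
                  (if prng p == x then g p else 0)).
  by case: ifP => // _; rewrite mulr0 addr0.
- exists 1 => // f; rewrite !ell2_norm_le//; apply: le_trans.
  apply: le_trans (pull_sqnorm _ (@vproj_inj x)).
  by rewrite le_eqVlt; apply/orP; left; apply/eqP; congr sqnorm; apply/funext => p /=;
    case: ifP.
Qed.

(* In particular the family intersected in path_algebra is not empty. *)
Lemma path_algebra_bounded : path_algebra `<=` @bounded_op R (dpath G).
Proof.
by apply: smallest_sub; [exact: bounded_op_closed|exact: generators_bounded].
Qed.

End PathAlgebra.

Arguments path_algebra : clear implicits.

Section Trees.
Variable G : digraph.

(* Indices run over 0, ..., n - 1 and ordS j is j + 1 mod n. *)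
Definition polygon (n : nat) (v : 'I_n -> vertex G) (e : 'I_n -> edge G) : Prop :=
  [/\ (1 <= n)%N, injective v, injective e &
      forall j, [set rng (e j); src (e j)] = [set v j; v (ordS j)]].

Definition arrow (x y : vertex G) : Prop := exists e, src e = x /\ rng e = y.

Definition is_tree : Prop :=
  [/\ finite_set [set: vertex G],
      exists x y : vertex G, x <> y,
      forall x y : vertex G, clos_refl_sym_trans _ arrow x y &
      forall n v e, ~ @polygon n v e].

Definition is_out_tree : Prop :=
  is_tree /\
  exists vs : vertex G, forall v : vertex G,
    exists p : dpath G, psrc p = vs /\ prng p = v.

End Trees.

(* Main.v *)
Require Import Defs.
From mathcomp Require Import all_boot all_order all_algebra.
From mathcomp Require Import complex.
From mathcomp Require Import all_classical all_reals all_analysis.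
From mathcomp Require Import zify.
Set Implicit Arguments.
Unset Strict Implicit.
Unset Printing Implicit Defensive.
Import Order.TTheory GRing.Theory Num.Theory.
Local Open Scope classical_set_scope.
Local Open Scope ring_scope.

(** Since an out-tree contains no polygon, a path is determined by its end
points ([walk_uniq]); as there are finitely many vertices, there are finitely
many paths, and the Hilbert space is finite-dimensional.  Let [vs] be the root,
[root y] the path from [vs] to [y], and [b w] the basis vector of a path [w].

The map [rtrans x] multiplies paths with source [x] on the right by [root x]:
it carries the paths with source [x] to paths with source [vs].  Elements of
the path algebra act by left multiplication, so they commute with every
[rtrans x] ([path_algebra_rtrans]), and the maps [rtrans x] together form an
isometry ([rtrans_pythagoras]).  Hence an element of the algebra is determined
by its values on the vectors [b (root y)] ([path_algebra_ext]), and its norm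
can be computed on the span of these vectors ([path_algebra_bound]).

That span is the left ideal [A L_vs] in disguise: a vector [g] in it
corresponds to the rank-one element [B] of the algebra that sends [b (root vs)]
to [g] and kills the other [b (root y)], and the norm of [B] is that of [g].
Applying the derivation [delta] to the ideal gives a linear map
[g |-> - delta B (b (root vs))] on the span; its norm is at most that of
[delta], and Leibniz' rule [delta (A B) = delta A B + A delta B] says exactly
that [delta A] is its commutator with [A].  What remains is that this map comes
from an element of the algebra ([implementer]).  Its value at [b (root x)] has
to be supported on paths that factor through [root x]; this follows from
Leibniz' rule for [L_x L_(root x) = L_(root x)] and from [delta L_x] being in
the algebra ([root_image_rtrans]). *)

(** * Walks in a graph without polygons *)

Section UniqueWalks.
Variable G : digraph.
Local Notation V := (vertex G).
Local Notation E := (edge G).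

Lemma walk_rng_cat (x : V) (a b : seq E) :
  walk_rng x (a ++ b) = walk_rng (walk_rng x b) a.
Proof. by case: a. Qed.

Lemma is_walk_cat (x : V) (a b : seq E) :
  is_walk x (a ++ b) = is_walk (walk_rng x b) a && is_walk x b.
Proof.
by elim: a => //= e a ->; rewrite walk_rng_cat andbA.
Qed.

(** A step [(x, e, y)] traverses the edge [e] from [x] to [y], along its
    orientation or against it. *)
Lemma closed_trail_polygon (s : seq (V * E * V)) :
  s != [::] -> uniq [seq t.1.1 | t <- s] -> uniq [seq t.1.2 | t <- s] ->
  (forall t, t \in s ->
     [set rng t.1.2; src t.1.2] = [set t.1.1; t.2] :> set V) ->
  cycle (fun t u => t.2 == u.1.1) s ->
  exists n v e, @polygon G n v e.
Proof.
case: s => // t0 s _ uv ue ends cyc; set s' := t0 :: s in uv ue ends *.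
exists (size s'), (fun j => (nth t0 s' j).1.1), (fun j => (nth t0 s' j).1.2).
have inj (T : eqType) (f : V * E * V -> T) : uniq (map f s') ->
    injective (fun j : 'I_(size s') => f (nth t0 s' j)).
  move=> uf i j; rewrite -!(nth_map _ (f t0))// => /eqP.
  by rewrite nth_uniq ?size_map// => /eqP/val_inj.
split=> //; [exact: inj uv|exact: inj ue|move=> j].
rewrite ends ?mem_nth//; congr [set _; _]; apply/eqP.
have /(pathP t0) /(_ j) : path (fun t u => t.2 == u.1.1) t0 (rcons s t0) := cyc.
rewrite size_rcons => /(_ (ltn_ord j)); rewrite -rcons_cons nth_rcons ltn_ord.
move=> /eqP ->; apply/eqP; congr (_.1.1).
rewrite nth_rcons /=; have := ltn_ord j; rewrite [size s']/= ltnS.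
rewrite leq_eqVlt => /orP[/eqP -> | js]; last by rewrite js modn_small ?ltnS.
by rewrite ltnn eqxx modnn.
Qed.

(** Two distinct walks of minimal total length with common end points form a
    polygon, traversed down [p] and back up [q].  A repeated vertex inside one walk
    would cut out a closed walk, to be compared with the empty one; a vertex or
    an edge common to both would split the pair into two shorter pairs with
    common end points.  Such shorter pairs coincide by induction. *)
Lemma walk_uniq (noP : forall n v e, ~ @polygon G n v e) (x : V) (p q : seq E) :
  is_walk x p -> is_walk x q -> walk_rng x p = walk_rng x q -> p = q.
Proof.
have [n] := ubnP (size p + size q); elim: n x p q => // n IH x p q szn wp wq pq.
apply: contrapT => neq.
pose down := [seq (rng e, e, src e) | e <- p].
pose up := [seq (src e, e, rng e) | e <- rev q].
have splitp e : e \in p -> exists a b, p = a ++ e :: b.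
  by move=> /path.splitPr[a b]; exists a, b.
have splitq e : e \in q -> exists a b, q = a ++ e :: b.
  by move=> /path.splitPr[a b]; exists a, b.
have disj e f : e \in p -> f \in q -> rng e <> src f.
  move=> /splitp[a [b ep]] /splitq[c [d eq]]; subst p q => ef.
  move: wp wq; rewrite !is_walk_cat /= => /and3P[wa /eqP eb wb] /and3P[wc /eqP fd wd].
  move: pq szn; rewrite !walk_rng_cat !size_cat /= => pq szn.
  have ebd : e :: b = d.
    by apply: (IH x) => //=; [lia|rewrite eb eqxx|rewrite ef fd].
  have acf : a = c ++ [:: f].
    apply: (IH (rng e)) => //=; first by rewrite size_cat /=; lia.
      by rewrite is_walk_cat /= wc ef eqxx.
    by rewrite walk_rng_cat.
  by apply: neq; rewrite acf ebd -catA.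
have disje e : e \in p -> e \in q -> False.
  move=> /splitp[a [b ep]] /splitq[c [d eq]]; subst p q.
  move: wp wq; rewrite !is_walk_cat /= => /and3P[wa /eqP eb wb] /and3P[wc /eqP ed wd].
  move: pq szn; rewrite !walk_rng_cat !size_cat /= => pq szn.
  have bd : b = d by apply: (IH x) => //; [lia|rewrite -eb -ed].
  have ac : a = c by apply: (IH (rng e)) => //; lia.
  by apply: neq; rewrite ac bd.
have urng r : is_walk x r -> (size r < n.+1)%N -> uniq [seq rng e | e <- r] .
  elim: r => //= e r IHr /andP[er wr] sz; rewrite IHr ?andbT//; last by lia.
  apply/negP => /mapP[f fr ef]; case/path.splitPr: fr er wr sz {IHr} => a b.
  rewrite walk_rng_cat is_walk_cat size_cat /= => /eqP er /and3P[wa /eqP fb wb] sz.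
  have : e :: a = [::] by apply: (IH (rng f)) => //=; [lia|rewrite er eqxx].
  by [].
have usrc r : is_walk x r -> (size r < n.+1)%N -> uniq [seq src e | e <- r] .
  elim: r => //= e r IHr /andP[er wr] sz; rewrite IHr ?andbT//; last by lia.
  apply/negP => /mapP[f fr ef]; case/path.splitPr: fr er wr sz {IHr} => a b.
  rewrite walk_rng_cat is_walk_cat size_cat /= => /eqP er /and3P[wa /eqP fb wb] sz.
  have : rcons a f = [::].
    apply: (IH (src f)) => //=; first by rewrite size_rcons; lia.
      by rewrite -cats1 is_walk_cat /= wa eqxx.
    by rewrite -cats1 walk_rng_cat /= -er ef.
  by case: (a).
have mdown1 : map (fun t => t.1.1) down = map (@rng G) p by rewrite -map_comp.
have mdown2 : map (fun t => t.1.2) down = p by rewrite -map_comp map_id.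
have mup1 : map (fun t => t.1.1) up = map (@src G) (rev q) by rewrite -map_comp.
have mup2 : map (fun t => t.1.2) up = rev q by rewrite -map_comp map_id.
have spn : (size p < n.+1)%N by lia.
have sqn : (size q < n.+1)%N by lia.
(* A step of [down] starts at the range of its edge and a step of [up] at the
   source, so the common end points are listed once even if [p] or [q] is
   empty. *)
suff [m [v [e]]] : exists n v e, @polygon G n v e by apply: noP.
apply: (@closed_trail_polygon (down ++ up)).
- apply/negP => /eqP/(congr1 size)/eqP; rewrite size_cat !size_map size_rev.
  rewrite addn_eq0 !size_eq0 => /andP[/eqP p0 /eqP q0].
  by apply: neq; rewrite p0 q0.
- rewrite map_cat mdown1 mup1 cat_uniq urng//= map_rev rev_uniq usrc// andbT.
  apply/hasPn => y; rewrite mem_rev => /mapP[f fq ->{y}].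
  by apply/negP => /mapP[e ep] /esym; apply: disj.
- rewrite map_cat mdown2 mup2 cat_uniq (map_uniq (urng _ wp spn)).
  rewrite rev_uniq (map_uniq (usrc _ wq sqn)) andbT; apply/hasPn => f.
  by rewrite mem_rev => fq; apply/negP => /disje; apply.
- move=> t; rewrite mem_cat => /orP[/mapP[e _ ->]//|/mapP[e _ ->]/=].
  exact: setUC.
- have pathdown (r : seq E) (y : V) : is_walk y r ->
     forall t, t.2 = walk_rng y r ->
     path (fun t u => t.2 == u.1.1) t [seq (rng e, e, src e) | e <- r] /\
     (last t [seq (rng e, e, src e) | e <- r]).2 = y.
    elim: r => //= e r IHr /andP[/eqP er wr] t ->; rewrite eqxx.
    by apply: IHr => //.
  have pathup (r : seq E) (y : V) : is_walk y r ->
     forall t, t.2 = y ->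
     path (fun t u => t.2 == u.1.1) t [seq (src e, e, rng e) | e <- rev r] /\
     (last t [seq (src e, e, rng e) | e <- rev r]).2 = walk_rng y r.
    elim: r => //= e r IHr /andP[/eqP er wr] t ty.
    rewrite rev_cons map_rcons rcons_path last_rcons /=.
    by have [-> ->] := IHr wr t ty; rewrite er eqxx.
  have cl t : t.2 = walk_rng x p ->
     path (fun t u => t.2 == u.1.1) t (down ++ up) /\
     (last t (down ++ up)).2 = walk_rng x p.
    move=> tx; rewrite cat_path last_cat.
    have [-> ld] := pathdown _ _ wp _ tx.
    by have [-> ->] := pathup _ _ wq _ ld.
  case E : (down ++ up) => [//|t s] /=.
  (* The last step ends where the first begins, so the list is also a path when
     preceded by its own last step. *)
  have [_] := cl (walk_rng x p, t.1.2, walk_rng x p) erefl.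
  rewrite E /= => lt.
  have := cl (last t s) lt; rewrite E /= => -[/andP[h ps] _].
  by rewrite rcons_path ps h.
Qed.

End UniqueWalks.

(** * Finite-dimensional Hilbert spaces *)

(* The word basis also names a topological notion. *)
Local Notation basis := Defs.basis.

Lemma big_single_term (M : nmodType) (I : eqType) (s : seq I) (P : pred I) (F : I -> M) k :
  uniq s -> k \in s -> (forall i, P i -> i != k -> F i = 0) ->
  \sum_(i <- s | P i) F i = if P k then F k else 0.
Proof.
move=> us ks F0; rewrite big_mkcond (bigD1_seq k)//= big1 ?addr0// => i ik.
by case: ifP => // /F0; apply.
Qed.

Section FiniteEll2.
Variables (R : realType) (I : choiceType).
Local Notation C := R[i].
Local Notation H := (ell2 R I).
Implicit Types (f g : H) (T : operator R I).

Lemma ell2D f g q : (f + g) q = f q + g q. Proof. by []. Qed.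
Lemma ell2Z (a : C) f q : (a *: f) q = a * f q. Proof. by []. Qed.

Lemma ell2_sum (J : Type) (r : seq J) (P : pred J) (a : J -> C) (g : J -> H) q :
  (\sum_(i <- r | P i) a i *: g i) q = \sum_(i <- r | P i) a i * g i q.
Proof.
elim: r => [|i r IH]; first by rewrite !big_nil.
by rewrite !big_cons; case: (P i); rewrite // ell2D ell2Z IH.
Qed.

Lemma basisE (w q : I) : basis R w q = (q == w)%:R.
Proof. by rewrite /=; case: eqP. Qed.

Lemma linear_op0 T : linear T -> T 0 = 0.
Proof.
by move=> linT; have := linT (-1) 0 0; rewrite scaler0 addr0 scaleN1r addNr.
Qed.

Lemma linear_sumZ T (J : Type) (r : seq J) (P : pred J) (a : J -> C) (g : J -> H) :
  linear T ->
  T (\sum_(i <- r | P i) a i *: g i) = \sum_(i <- r | P i) a i *: T (g i).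
Proof.
move=> linT; elim: r => [|i r IH]; first by rewrite !big_nil linear_op0.
by rewrite !big_cons; case: (P i); rewrite // linT IH.
Qed.

Lemma linear_opZ T (a : C) f : linear T -> T (a *: f) = a *: T f.
Proof.
move=> linT; have := @linear_sumZ T _ [:: tt] predT (fun=> a) (fun=> f) linT.
by rewrite !big_seq1.
Qed.

Lemma operator_sum (J : Type) (r : seq J) (P : pred J) (a : J -> C)
    (g : J -> operator R I) f :
  (\sum_(i <- r | P i) a i *: g i) f = \sum_(i <- r | P i) a i *: g i f.
Proof. by rewrite fct_sumE. Qed.

Lemma le_opnorm T f : ell2_norm f <= 1 -> ((ell2_norm (T f))%:E <= opnorm T)%E.
Proof. by move=> f1; apply: ereal_sup_ubound; exists f. Qed.

Lemma ell2_norm_ge0 f : 0 <= ell2_norm f.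
Proof. exact: sqrtr_ge0. Qed.

Lemma ell2_norm_zero : ell2_norm (0 : H) = 0.
Proof. by rewrite /ell2_norm [sqnorm _]sqnorm0 sqrtr0. Qed.

Lemma normc_real (c : R) : Normc.normc (c%:C)%C ^+ 2 = c ^+ 2.
Proof. by rewrite normc2 /= expr0n addr0. Qed.

Lemma ell2_normZ (a : C) f :
  ell2_norm (a *: f) ^+ 2 = Normc.normc a ^+ 2 * ell2_norm f ^+ 2.
Proof. by apply: EFin_inj; rewrite -sqnormE EFinM -sqnormE; exact: sqnormZ. Qed.

Lemma ell2_normN f : ell2_norm (- f) = ell2_norm f.
Proof.
apply/eqP; rewrite -(@eqrXn2 _ 2) ?ell2_norm_ge0//; apply/eqP.
by rewrite -scaleN1r ell2_normZ (normcN (1 : C)) Normc.normc1 expr1n mul1r.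
Qed.

Variable s : seq I.
Hypotheses (us : uniq s) (ins : forall i, i \in s).

Lemma ell2_normE f : ell2_norm f ^+ 2 = \sum_(i <- s) Normc.normc (f i) ^+ 2.
Proof.
apply: EFin_inj; rewrite -sqnormE /sqnorm.
have sT : [set: I] = [set` s] by apply/seteqP; split=> // i _ /=.
rewrite esum_fset; first by rewrite sT -fsbig_seq// sumEFin.
- by rewrite sT; apply/finite_seqP; exists s.
- by move=> i _; rewrite lee_fin sqr_ge0.
Qed.

Lemma ell2_expand f : f = \sum_(w <- s) f w *: basis R w.
Proof.
apply/val_inj/funext => q /=; rewrite ell2_sum (@big_single_term _ _ _ _ _ q)//=.
  by rewrite eqxx mulr1.
by move=> i _ /negbTE; rewrite eq_sym => ->; rewrite mulr0.
Qed.

Lemma normcD_le (x y : C) : Normc.normc (x + y) <= Normc.normc x + Normc.normc y.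
Proof. exact: le_normcD. Qed.

Lemma normcB_le (x y : C) : Normc.normc (x - y) <= Normc.normc x + Normc.normc y.
Proof. by apply: le_trans (normcD_le _ _) _; rewrite (normcN y). Qed.

Lemma normc_nneg (z : C) : 0 <= Normc.normc z.
Proof. by case: z => a b; exact: sqrtr_ge0. Qed.

Lemma normc_coord_le f q : Normc.normc (f q) <= ell2_norm f.
Proof.
rewrite -(@ler_pXn2r _ 2)// ?nnegrE ?normc_nneg ?ell2_norm_ge0//.
rewrite ell2_normE (bigD1_seq q)//= lerDl sumr_ge0// => i _; exact: sqr_ge0.
Qed.

Lemma ell2_norm_basis (w : I) : ell2_norm (basis R w) = 1.
Proof.
apply/eqP; rewrite -(@eqrXn2 _ 2) ?ell2_norm_ge0//; apply/eqP.
rewrite ell2_normE (@big_single_term _ _ _ _ _ w)//= ?eqxx.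
  by rewrite Normc.normc1.
by move=> i _ /negbTE ->; rewrite Normc.normc0 expr0n.
Qed.

Lemma ell2_norm0 f : ell2_norm f = 0 -> f = 0.
Proof.
move=> f0; apply/val_inj/funext => q; apply: Normc.eq0_normc.
by apply/eqP; rewrite eq_le normc_nneg andbT -f0; exact: normc_coord_le.
Qed.

End FiniteEll2.

(** * Operators in the path algebra *)

Section PathAlgebraClosure.
Variables (R : realType) (I : choiceType) (Gen : set (operator R I)).

Lemma smallest_subalgebra_closed : Gen `<=` @bounded_op R I ->
  closed_subalgebra (smallest (@closed_subalgebra R I) Gen).
Proof.
move=> bG; split.
- apply: smallest_sub => //; exact: bounded_op_closed.
- by move=> X [[]].
- move=> a S T AS AT X XG; have [[_ _ h _ _] _] := XG.
  by apply: h; [exact: AS|exact: AT].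
- move=> S T AS AT X XG; have [[_ _ _ h _] _] := XG.
  by apply: h; [exact: AS|exact: AT].
- move=> T bT app X XG; have [[_ _ _ _ h] _] := XG.
  apply: h => // eps /app[S AS ST]; exists S => //; exact: AS.
Qed.

End PathAlgebraClosure.

Section RootedPaths.
Variables (R : realType) (G : digraph).
Local Notation C := R[i].
Local Notation P := (dpath G).
Local Notation H := (ell2 R (dpath G)).
Local Notation alg := (path_algebra R G).
Local Notation b := (@basis R (dpath G)).

Lemma path_algebra_closed : closed_subalgebra alg.
Proof. by apply: smallest_subalgebra_closed; exact: generators_bounded. Qed.

Lemma path_algebra_linear A : alg A -> linear A.
Proof. by move=> /path_algebra_bounded[]. Qed.

Lemma path_algebra0 : alg 0.
Proof. by have [] := path_algebra_closed. Qed.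

Lemma path_algebraD (a : C) S T : alg S -> alg T -> alg (a *: S + T).
Proof. by have [_ _ + _ _] := path_algebra_closed; apply. Qed.

Lemma path_algebraM S T : alg S -> alg T -> alg (S \o T).
Proof. by have [_ _ _ + _] := path_algebra_closed; apply. Qed.

Lemma path_algebra_sum (J : Type) (r : seq J) (p : pred J) (a : J -> C)
    (g : J -> operator R P) :
  (forall i, alg (g i)) -> alg (\sum_(i <- r | p i) a i *: g i).
Proof.
move=> gA; elim: r => [|i r IH]; first by rewrite big_nil; exact: path_algebra0.
by rewrite big_cons; case: (p i) => //; exact: path_algebraD.
Qed.

Lemma path_algebra_vertex x : alg (@L_vertex R G x).
Proof. by apply: sub_gen_smallest; right; exists x. Qed.

Lemma path_algebra_edge e : alg (@L_edge R G e).
Proof. by apply: sub_gen_smallest; left; exists e. Qed.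

Definition L_path (u : P) : operator R P :=
  foldr (fun e T => @L_edge R G e \o T) (@L_vertex R G (val u).1) (val u).2.

Lemma path_algebra_path u : alg (L_path u).
Proof.
rewrite /L_path; elim: (val u).2 => [|e es IH] /=; first exact: path_algebra_vertex.
by apply: path_algebraM => //; exact: path_algebra_edge.
Qed.

Lemma L_path_basis (u w : P) : psrc u = prng w ->
  exists v, [/\ L_path u (b w) = b v, psrc v = psrc w & prng v = prng u].
Proof.
rewrite /L_path /prng /psrc; case: u => -[x es] /= ; elim: es => [|e es IH] /=.
  by move=> _ xw; exists w; split=> //; rewrite L_vertex_basis /prng xw eqxx.
move=> /andP[/eqP ee wes] xw; have [v [vE vs vr]] := IH wes xw.
rewrite [foldr _ _ _ _]vE L_edge_basis /pcons; case: insubP => [v' _ v'E|].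
  by exists v'; rewrite v'E.
by rewrite /= ee vr eqxx (valP v).
Qed.

Lemma L_path_basis0 (u w : P) : psrc u <> prng w -> L_path u (b w) = 0.
Proof.
rewrite /L_path /psrc; case: u => -[x es] /= _ xw.
elim: es => [|e es IH] /=; first by rewrite L_vertex_basis; case: eqP => // /esym.
rewrite [foldr _ _ _ _]IH.
have := @linear_opZ _ _ (@L_edge R G e) 0 0 (path_algebra_linear (path_algebra_edge e)).
by rewrite !scale0r.
Qed.

(** What is used of an out-tree: an enumeration [s] of its paths, the
    determination of a path by its end points, and a path [root y] from a fixed
    vertex [vs] to each vertex [y]. *)
Variables (s : seq P) (us : uniq s) (ins : forall w, w \in s).
Hypothesis ends_inj : forall p q : P, psrc p = psrc q -> prng p = prng q -> p = q.
Variables (vs : vertex G) (root : vertex G -> P).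
Hypotheses (root_src : forall y, psrc (root y) = vs)
           (root_rng : forall y, prng (root y) = y).

Lemma rootP q : psrc q = vs -> q = root (prng q).
Proof. by move=> qs; apply: ends_inj; rewrite ?root_src ?root_rng. Qed.

Lemma root_inj : injective root.
Proof. by move=> x y xy; rewrite -[x]root_rng xy root_rng. Qed.

Lemma L_path_root (u : P) y :
  L_path u (b (root y)) = if psrc u == y then b (root (prng u)) else 0.
Proof.
case: eqP => [uy|uy]; last by apply: L_path_basis0; rewrite root_rng.
have [|v [-> v1 v2]] := @L_path_basis u (root y); first by rewrite root_rng.
by rewrite -v2 -rootP// v1 root_src.
Qed.

(** Right multiplication by the path [root x].  For a path [w] with source [x],
    the product [w (root x)] is the path from [vs] to the range of [w], that is,
    [root (prng w)]. *)
Definition rtrans (x : vertex G) : operator R P := fun f =>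
  \sum_(w <- s | psrc w == x) f w *: b (root (prng w)).

Lemma rtrans_linear x : linear (rtrans x).
Proof.
move=> a f g; rewrite /rtrans scaler_sumr -big_split.
by apply: eq_bigr => w _; rewrite ell2D ell2Z scalerDl scalerA.
Qed.

Lemma rtrans_basis x w :
  rtrans x (b w) = if psrc w == x then b (root (prng w)) else 0.
Proof.
rewrite /rtrans (@big_single_term _ _ _ _ _ w)// ?basisE ?eqxx ?scale1r//.
by move=> i _ /negbTE iw; rewrite basisE iw scale0r.
Qed.

(** No information is lost: the coordinate at [w] reappears at [root (prng w)],
    since [w] is determined by its source and its range. *)
Lemma rtrans_coord f w : rtrans (psrc w) f (root (prng w)) = f w.
Proof.
rewrite /rtrans ell2_sum (@big_single_term _ _ _ _ _ w)// ?basisE ?eqxx ?mulr1// => i.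
move=> /eqP iw inw; rewrite basisE; case: eqP => [/root_inj wi|_].
  by case/eqP: inw; exact: ends_inj.
by rewrite mulr0.
Qed.

Lemma rtrans_inj f g : (forall x, rtrans x f = rtrans x g) -> f = g.
Proof.
move=> fg; apply/val_inj/funext => w /=; rewrite -[LHS]rtrans_coord.
by rewrite -[RHS]rtrans_coord fg.
Qed.

Lemma rtrans_norm x f :
  ell2_norm (rtrans x f) ^+ 2 = \sum_(w <- s | psrc w == x) Normc.normc (f w) ^+ 2.
Proof.
rewrite (ell2_normE us ins).
pose t := [seq root (prng w) | w <- s & psrc w == x].
rewrite (bigID (mem t))/= [X in _ + X]big1 ?addr0; last first.
  move=> q qt; rewrite /rtrans ell2_sum big1_seq ?Normc.normc0 ?expr0n// => w.
  move=> /andP[wx ws]; rewrite basisE; case: eqP => [qw|_]; last by rewrite mulr0.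
  by case/negP: qt; rewrite qw; apply/mapP; exists w; rewrite // mem_filter wx.
rewrite -big_filter (perm_big t); last first.
  apply: uniq_perm; first exact: filter_uniq.
    rewrite map_inj_in_uniq ?filter_uniq// => w v.
    rewrite !mem_filter => /andP[/eqP wx _] /andP[/eqP vx _] /root_inj wv.
    by apply: ends_inj => //; rewrite wx.
  by move=> q; rewrite mem_filter ins andbT.
rewrite big_map big_filter; apply: eq_bigr => w /eqP <-.
by rewrite rtrans_coord.
Qed.

Lemma rtrans_pythagoras f :
  \sum_(x <- undup [seq psrc w | w <- s]) ell2_norm (rtrans x f) ^+ 2 =
  ell2_norm f ^+ 2.
Proof.
under eq_bigr => x _ do rewrite rtrans_norm big_mkcond.
rewrite exchange_big (ell2_normE us ins); apply: eq_bigr => w _.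
rewrite (@big_single_term _ _ _ predT _ (psrc w)) ?undup_uniq//= ?eqxx//.
  by rewrite mem_undup map_f.
by move=> x _ /negbTE; rewrite eq_sym => ->.
Qed.

(** Commutation is only required on basis vectors, where it passes to norm
    limits by an estimate on finitely many coordinates. *)
Definition rtrans_commutant : set (operator R P) :=
  [set A | bounded_op A /\ forall x w, A (rtrans x (b w)) = rtrans x (A (b w))].

Lemma rtrans_commute A : rtrans_commutant A -> forall x f, A (rtrans x f) = rtrans x (A f).
Proof.
move=> [[linA _] comm] x f; rewrite {1}/rtrans linear_sumZ//.
rewrite [in RHS](ell2_expand us ins f) (linear_sumZ _ _ _ _ linA).
rewrite (linear_sumZ _ _ _ _ (rtrans_linear x)) big_mkcond; apply: eq_bigr => w _.
rewrite -comm rtrans_basis; case: ifP => // _.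
by rewrite linear_op0// scaler0.
Qed.

Lemma rtrans_commutant_closed : closed_subalgebra rtrans_commutant.
Proof.
have [bB b0 bD bM _] := @bounded_op_closed R P.
split.
- by move=> A [].
- by split=> // x w; rewrite [RHS]linear_op0//; exact: rtrans_linear.
- move=> a S T [bS cS] [bT cT]; split; first exact: bD.
  move=> x w; have := rtrans_linear x a (S (b w)) (T (b w)).
  by rewrite -cS -cT.
- move=> S T cS cT; split; first by apply: bM; [case: cS|case: cT].
  by move=> x w /=; rewrite !rtrans_commute.
- move=> T bT app; split=> // x w.
  have linT : linear T by case: bT.
  apply/eqP; rewrite -subr_eq0; apply/eqP; apply/val_inj/funext => q.
  apply: Normc.eq0_normc; apply/eqP; rewrite eq_le normc_nneg andbT.
  apply/ler_addgt0Pl => eps eps0; rewrite addr0.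
  (* Approximate [T] by [S] up to [eps / K]: the defect of [T - S] at [q] is one
     coordinate minus a sum of at most [size s] coordinates. *)
  set K : R := 1 + (size s)%:R.
  have K0 : 0 < K by rewrite ltr_wpDr ?ler0n.
  have [S [[linS _] cS] ST] := app (eps / K) (divr_gt0 eps0 K0).
  pose D : operator R P := T - S.
  have linD : linear D.
    move=> a f g; rewrite /D -[LHS]/(T (a *: f + g) - S (a *: f + g)) linT linS.
    by rewrite opprD addrACA -scalerBr.
  have De f : ell2_norm f <= 1 -> forall p, Normc.normc (D f p) <= eps / K.
    move=> f1 p; apply: (le_trans (normc_coord_le us ins _ _)).
    rewrite -lee_fin; apply: le_trans (ltW ST); exact: le_opnorm.
  have -> : T (rtrans x (b w)) - rtrans x (T (b w)) =
            D (rtrans x (b w)) - rtrans x (D (b w)).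
    rewrite -[D (rtrans _ _)]/(T _ - S _) -[D (b w)]/(T _ - S _) cS.
    have := rtrans_linear x (-1) (S (b w)) (T (b w)).
    rewrite !scaleN1r [X in rtrans x X]addrC => ->.
    by rewrite opprD opprK addrA addrNK.
  rewrite -[X in Normc.normc X]/(D (rtrans x (b w)) q - rtrans x (D (b w)) q).
  apply: le_trans (normcB_le _ _) _.
  have -> : eps = eps / K + (size s)%:R * (eps / K).
    by rewrite -[X in X + _]mul1r -mulrDl -/K mulrC divfK// gt_eqF.
  apply: lerD.
    apply: De; rewrite rtrans_basis; case: ifP => _.
      by rewrite (ell2_norm_basis R us ins).
    by rewrite ell2_norm_zero.
  have De1 p : Normc.normc (D (b w) p) <= eps / K.
    by apply: De; rewrite (ell2_norm_basis R us ins).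
  have e0 : 0 <= eps / K by rewrite ltW// divr_gt0.
  rewrite /rtrans ell2_sum; elim: (s) => [|i r IH].
    by rewrite big_nil Normc.normc0 mul0r.
  rewrite big_cons.
  have -> : (size (i :: r))%:R * (eps / K) = (eps / K) + (size r)%:R * (eps / K).
    by rewrite [size _]/= mulrSr mulrDl mul1r addrC.
  case: ifP => _; last by apply: le_trans IH _; rewrite lerDr.
  apply: le_trans (normcD_le _ _) _.
  apply: lerD => //; rewrite basisE; case: eqP => _; first by rewrite mulr1.
  by rewrite mulr0 Normc.normc0.
Qed.

(** Left multiplication by an edge or by a vertex commutes with right
    multiplication by [root x]. *)
Lemma path_algebra_commutant : alg `<=` rtrans_commutant.
Proof.
apply: smallest_sub; first exact: rtrans_commutant_closed.
have lin0 x := linear_op0 (rtrans_linear x).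
move=> T GT; split; first exact: generators_bounded.
case: GT => [[e _ <-]|[y _ <-]] x w.
- have e0 := linear_op0 (path_algebra_linear (path_algebra_edge e)).
  rewrite rtrans_basis L_edge_basis; case: ifP => [/eqP wx|wx].
    rewrite L_edge_basis.
    have := pcons_defined e (root (prng w)); have := pcons_defined e w.
    rewrite root_rng /pcons; case: insubP => [u _ uE|_]; case: insubP => [v _ vE|_] //=;
      [|by move=> <-|by move=> <-].
    move=> _ _; rewrite rtrans_basis /psrc uE /= -/(psrc w) wx eqxx; congr b.
    have vvs : psrc v = vs by rewrite /psrc vE; exact: root_src.
    by rewrite (rootP vvs) /prng uE vE.
  rewrite e0 /pcons; case: insubP => [u _ uE|_]; last by rewrite lin0.
  by rewrite rtrans_basis /psrc uE /= -/(psrc w) wx.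
- have e0 := linear_op0 (path_algebra_linear (path_algebra_vertex y)).
  rewrite rtrans_basis L_vertex_basis; case: ifP => [wx|wx].
    rewrite L_vertex_basis root_rng; case: ifP => _; last by rewrite lin0.
    by rewrite rtrans_basis wx.
  by rewrite e0; case: ifP => _; rewrite ?lin0// rtrans_basis wx.
Qed.

Lemma path_algebra_rtrans A x f : alg A -> A (rtrans x f) = rtrans x (A f).
Proof. by move=> /path_algebra_commutant/rtrans_commute. Qed.

Lemma path_algebra_ext A B : alg A -> alg B ->
  (forall y, A (b (root y)) = B (b (root y))) -> A = B.
Proof.
move=> hA hB AB; apply/funext => f; apply: rtrans_inj => x.
rewrite -(path_algebra_rtrans x f hA) -(path_algebra_rtrans x f hB) /rtrans.
rewrite !linear_sumZ; try exact: path_algebra_linear.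
by apply: eq_bigr => w _; rewrite AB.
Qed.

(** The norm of an element of the algebra is attained on the span of the vectors
    [b (root y)], as [rtrans] splits a vector isometrically into pieces in that
    span and commutes with [A]. *)
Lemma path_algebra_bound A (M : R) : alg A -> 0 <= M ->
  (forall x f, ell2_norm (rtrans x f) <= 1 -> ell2_norm (A (rtrans x f)) <= M) ->
  (opnorm A <= M%:E)%E.
Proof.
move=> hA M0 AM; apply: ge_ereal_sup => _ [f /= f1 <-]; rewrite lee_fin.
have linA := path_algebra_linear hA.
have step x : ell2_norm (rtrans x (A f)) ^+ 2 <= M ^+ 2 * ell2_norm (rtrans x f) ^+ 2.
  rewrite -path_algebra_rtrans//; set g := rtrans x f.
  have [/(ell2_norm0 us ins) ->|gN0] := eqVneq (ell2_norm g) 0.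
    by rewrite linear_op0// ell2_norm_zero expr0n mulr0.
  pose c : R := ell2_norm g.
  have c0 : 0 < c by rewrite lt0r gN0 ell2_norm_ge0.
  have /AM : ell2_norm (rtrans x ((c^-1)%:C%C *: f)) <= 1.
    rewrite -(@ler_pXn2r _ 2)// ?nnegrE ?ell2_norm_ge0//.
    rewrite linear_opZ; last exact: rtrans_linear.
    by rewrite ell2_normZ normc_real -exprMn mulVf// gt_eqF.
  rewrite linear_opZ; last exact: rtrans_linear.
  rewrite linear_opZ// -/g -(@ler_pXn2r _ 2)// ?nnegrE ?ell2_norm_ge0//.
  by rewrite ell2_normZ normc_real exprVn ler_pdivrMl ?exprn_gt0// mulrC.
rewrite -(@ler_pXn2r _ 2)// ?nnegrE ?ell2_norm_ge0// -(rtrans_pythagoras (A f)).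
apply: le_trans (ler_sum _ (fun x _ => step x)) _.
rewrite -mulr_sumr rtrans_pythagoras ler_piMr ?sqr_ge0//.
by rewrite expr_le1 ?ell2_norm_ge0.
Qed.

(** * The operator implementing a derivation *)

Variable delta : operator R P -> operator R P.
Hypothesis hdelta : derivation_on alg delta.

Lemma derivation_stable A : alg A -> alg (delta A).
Proof. by have [+ _ _] := hdelta; apply. Qed.

Lemma derivation_sum (J : Type) (r : seq J) (p : pred J) (a : J -> C)
    (g : J -> operator R P) : (forall i, alg (g i)) ->
  delta (\sum_(i <- r | p i) a i *: g i) = \sum_(i <- r | p i) a i *: delta (g i).
Proof.
move=> gA; have [_ lin _] := hdelta.
elim: r => [|i r IH].
  rewrite !big_nil; have := lin (-1) 0 0 path_algebra0 path_algebra0.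
  by rewrite scaler0 addr0 scaleN1r addNr.
rewrite !big_cons; case: (p i) => //; rewrite lin ?IH//.
exact: path_algebra_sum.
Qed.

(** The negative of the image of [b (root x)] under the operator sought. *)
Definition root_image (x : vertex G) : H := delta (L_path (root x)) (b (root vs)).

Lemma root_image_sum x g :
  root_image x = rtrans x g ->
  \sum_(u <- s | psrc u == x) root_image x (root (prng u)) *: b (root (prng u)) =
  root_image x.
Proof.
move=> e; rewrite {2}e /rtrans; apply: eq_bigr => u /eqP ux.
by rewrite e -ux rtrans_coord.
Qed.

Lemma trivial_path x : exists w : P, psrc w = x /\ prng w = x.
Proof. by exists (exist _ (x, [::]) isT). Qed.

(** This says that [root_image x] is supported on paths that factor through
    [root x], as the image of [b (root x)] under an element of the algebra must
    be.  Leibniz' rule for [L_x L_(root x) = L_(root x)] splits it into two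
    terms.  One is the image of [b (root x)] under [delta L_x]; the other is
    supported on paths from [vs] to [x], hence a multiple of [b (root x)]. *)
Lemma root_image_rtrans x : exists g, root_image x = rtrans x g.
Proof.
have [ix [ixs ixr]] := trivial_path x.
have [iv [ivs ivr]] := trivial_path vs.
have ixE : rtrans x (b ix) = b (root x) by rewrite rtrans_basis ixs eqxx ixr.
have ivE : rtrans vs (b iv) = b (root vs) by rewrite rtrans_basis ivs eqxx ivr.
have [_ _ prod] := hdelta.
have Ax := path_algebra_vertex x; have Ar := path_algebra_path (root x).
have linx := path_algebra_linear Ax.
have ELL : @L_vertex R G x \o L_path (root x) = L_path (root x).
  apply: path_algebra_ext => [||y] //=; first exact: path_algebraM.
  rewrite L_path_root; case: ifP => _; last exact: linear_op0.
  by rewrite L_vertex_basis !root_rng eqxx.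
set A := delta (@L_vertex R G x).
set h := delta (L_path (root x)) (b iv).
have dE : root_image x = A (b (root x)) + @L_vertex R G x (root_image x).
  rewrite {1}/root_image -ELL prod// -[LHS]/(A _ + @L_vertex R G x _).
  by rewrite L_path_root root_src eqxx root_rng.
have hE : root_image x = rtrans vs h.
  by rewrite /root_image -ivE path_algebra_rtrans//; exact: derivation_stable.
pose k := \sum_(w <- s | psrc w == vs) h w *: (if prng w == x then b ix else 0).
exists (A (b ix) + k).
have linsh := rtrans_linear x.
have -> : rtrans x (A (b ix) + k) = rtrans x (A (b ix)) + rtrans x k.
  by have := linsh 1 (A (b ix)) k; rewrite !scale1r.
rewrite [LHS]dE -ixE path_algebra_rtrans; last exact: derivation_stable.
congr (_ + _); rewrite hE {1}/rtrans /k !linear_sumZ//.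
apply: eq_bigr => w _; rewrite L_vertex_basis root_rng.
by case: eqP => [->|_]; [rewrite ixE|rewrite (linear_op0 linsh)].
Qed.

(** As [u (root (psrc u))] is the path [root (prng u)], the coefficient of
    [L_path u] in an element of the algebra is the coordinate at
    [root (prng u)] of the image of [b (root (psrc u))]. *)
Definition implementer : operator R P :=
  \sum_(u <- s) - root_image (psrc u) (root (prng u)) *: L_path u.

Lemma path_algebra_implementer : alg implementer.
Proof. by apply: path_algebra_sum => u; exact: path_algebra_path. Qed.

Lemma implementer_root x : implementer (b (root x)) = - root_image x.
Proof.
have [g gE] := root_image_rtrans x; rewrite -[in RHS](root_image_sum gE).
rewrite /implementer operator_sum -sumrN [RHS]big_mkcond; apply: eq_bigr => u _.
by rewrite L_path_root; case: eqP => [->|_]; rewrite ?scaleNr// scaler0 oppr0.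
Qed.

(** On the span of the vectors [b (root y)], the implementer is [- delta] seen
    through the rank-one elements described in [sum_L_path_root]. *)
Lemma implementer_rtrans x (g : H) :
  implementer (rtrans x g) =
  - delta (\sum_(w <- s | psrc w == x) g w *: L_path (root (prng w))) (b (root vs)).
Proof.
rewrite derivation_sum; last by move=> w; exact: path_algebra_path.
rewrite operator_sum /rtrans linear_sumZ; last first.
  exact: path_algebra_linear path_algebra_implementer.
by rewrite -sumrN; apply: eq_bigr => w _; rewrite implementer_root scalerN.
Qed.

(** The rank-one operator that sends [b (root vs)] to [rtrans x g]. *)
Lemma sum_L_path_root x (g : H) y :
  (\sum_(w <- s | psrc w == x) g w *: L_path (root (prng w))) (b (root y)) =
  b (root y) (root vs) *: rtrans x g.
Proof.
rewrite operator_sum basisE (inj_eq root_inj).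
under eq_bigr => w _ do rewrite L_path_root root_src root_rng.
by case: eqP => _; rewrite ?scale1r// scale0r big1// => w _; rewrite scaler0.
Qed.

(** Leibniz' rule for [A L_(root y)], evaluated at [b (root vs)]. *)
Lemma implementer_inner A : alg A -> delta A = delta_ implementer A.
Proof.
move=> hA; have hT := path_algebra_implementer; have [_ _ prod] := hdelta.
have linA := path_algebra_linear hA.
have dT : alg (delta_ implementer A).
  by rewrite /delta_ addrC -scaleN1r; apply: path_algebraD; exact: path_algebraM.
apply: path_algebra_ext => // [|y]; first exact: derivation_stable.
have hr := path_algebra_path (root y).
have [iy [iys iyr]] := trivial_path y.
have iyE : rtrans y (b iy) = b (root y) by rewrite rtrans_basis iys eqxx iyr.
have := congr1 (fun B => B (b (root vs))) (prod _ _ hA hr).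
set g := A (b iy).
have -> : A \o L_path (root y) =
    \sum_(w <- s | psrc w == y) g w *: L_path (root (prng w)).
  apply: path_algebra_ext => [||z].
  - exact: path_algebraM.
  - by apply: path_algebra_sum => w; exact: path_algebra_path.
  rewrite sum_L_path_root /= L_path_root root_src root_rng (inj_eq root_inj) eq_sym.
  rewrite -path_algebra_rtrans// iyE.
  by case: eqP => _; rewrite ?scale1r// scale0r linear_op0.
rewrite -[delta _ _]opprK -implementer_rtrans -path_algebra_rtrans// iyE.
rewrite -[X in _ = X -> _]/(delta A (L_path (root y) (b (root vs))) + A (root_image y)).
rewrite L_path_root root_src eqxx root_rng => e.
rewrite -[RHS]/(A (implementer _) - implementer (A _)) implementer_root.
rewrite -scaleN1r linear_opZ// scaleN1r e.
by rewrite addrC addrK.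
Qed.

(** The rank-one element [B] attached to a vector [g] has the norm of [g], so that
    [|- delta B (b (root vs))| <= |delta| |g|]. *)
Lemma opnorm_implementer : (opnorm implementer <= norm_on alg delta)%E.
Proof.
have hT := path_algebra_implementer.
have bound x g : ell2_norm (rtrans x g) <= 1 ->
    ((ell2_norm (implementer (rtrans x g)))%:E <= norm_on alg delta)%E.
  move=> g1; rewrite implementer_rtrans.
  set B := \sum_(w <- s | _) _.
  have hB : alg B by apply: path_algebra_sum => w; exact: path_algebra_path.
  have linB := path_algebra_linear hB.
  have BE z f : B (rtrans z f) = rtrans z f (root vs) *: rtrans x g.
    rewrite {1 2}/rtrans linear_sumZ// ell2_sum scaler_suml.
    by apply: eq_bigr => w _; rewrite /B sum_L_path_root scalerA.
  have B1 : (opnorm B <= 1)%E.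
    apply: path_algebra_bound => // z f f1.
    rewrite -(@ler_pXn2r _ 2)// ?nnegrE ?ell2_norm_ge0// BE ell2_normZ expr1n.
    rewrite mulr_ile1 ?sqr_ge0// expr_le1 ?ell2_norm_ge0 ?normc_nneg//.
    by apply: le_trans f1; exact: (normc_coord_le us ins).
  rewrite ell2_normN; apply: (@le_trans _ _ (opnorm (delta B))).
    by apply: le_opnorm; rewrite (ell2_norm_basis R us ins).
  by apply: ereal_sup_ubound; exists B.
have N0 : (0 <= norm_on alg delta)%E.
  have sh0 : rtrans vs 0 = 0 := linear_op0 (rtrans_linear vs).
  have := bound vs 0; rewrite sh0 ell2_norm_zero => /(_ ler01); apply: le_trans.
  by rewrite lee_fin ell2_norm_ge0.
case N : (norm_on alg delta) N0 bound => [M| |] //; last by move=> _ _; exact: leey.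
rewrite lee_fin => M0 bound; apply: path_algebra_bound => // x g /bound.
Qed.

End RootedPaths.

Lemma finite_dpath (G : digraph) : finite_set [set: vertex G] ->
  (forall p q : dpath G, psrc p = psrc q -> prng p = prng q -> p = q) ->
  finite_set [set: dpath G].
Proof.
move=> finV inj; rewrite -(preimage_setT (fun p : dpath G => (psrc p, prng p))).
apply: finite_preimage => [p q _ _ [] /inj pq /pq//|].
by rewrite -setXTT; exact: finite_setX.
Qed.

Theorem proposition6p25 (R : realType) (G : digraph) (hG : is_out_tree G)
    (delta : operator R (dpath G) -> operator R (dpath G))
    (hdelta : derivation_on (path_algebra R G) delta) :
  exists T : operator R (dpath G),
    [/\ path_algebra R G T,
        (forall A, path_algebra R G A -> delta A = delta_ T A) &
        (opnorm T <= norm_on (path_algebra R G) delta)%E].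
Proof.
have [[finV _ _ noP] [vs /choice[root rootP]]] := hG.
have root_src y : psrc (root y) = vs by case: (rootP y).
have root_rng y : prng (root y) = y by case: (rootP y).
have inj (p q : dpath G) : psrc p = psrc q -> prng p = prng q -> p = q.
  case: p q => -[x es] /= wes [[y fs] /= wfs]; rewrite /psrc /prng /= => xy.
  by subst y => pq; apply/val_inj => /=; rewrite (walk_uniq noP wes wfs pq).
have /finite_seqP[s0 sE] := finite_dpath finV inj.
have us : uniq (undup s0) := undup_uniq s0.
have ins (w : dpath G) : w \in undup s0.
  by rewrite mem_undup; have : [set: dpath G] w by []; rewrite sE.
exists (implementer (undup s0) vs root delta); split.
- exact: path_algebra_implementer.
- move=> A; exact: (implementer_inner us ins inj root_src root_rng hdelta).
- exact: (opnorm_implementer us ins inj root_src root_rng hdelta).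
Qed.
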